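(* Let $E$ be a pseudo effect algebra with (RDP), and let $t$ be a fixed measure on $E$. Then every measure $m$ on $E$ can be uniquely expressed in the form $m=m_1+m_2$, where $m_1$ and $m_2$ are (finitely additive) measures on $E$ such that $m_1\ll_\epsilon t$, and if $m'$ is any measure on $E$ with $m'\ll_\epsilon t$ and $m'\le^+m_2$, then $m'=0$. Moreover, $m_2\wedge t=0$. In particular, every state $s$ on $E$ can be uniquely expressed as a convex combination $s=\lambda_1s_1+\lambda_2s_2$ of two states $s_1$ and $s_2$ on $E$, where $s_1\ll_\epsilon t$, and if $s'$ is any state with $s'\ll_\epsilon t$ and $\alpha s'\le^+s_2$ for a constant $\alpha\ge0$, then $\alpha=0$.
   Context: A pseudo effect algebra is a partial algebra $(E;+,0,1)$ with a partial binary operation $+$ and constants $0,1$ such that for all $a,b,c\in E$: (i) $a+b$ and $(a+b)+c$ exist iff $b+c$ and $a+(b+c)$ exist, and then $(a+b)+c=a+(b+c)$; (ii) there is exactly one $d$ and exactly one $e$ in $E$ with $a+d=e+a=1$; (iii) if $a+b$ exists, there are $d,e\in E$ with $a+b=d+a=b+e$; (iv) if $1+a$ or $a+1$ exists, then $a=0$. $E$ has (RDP) if whenever $a_1+a_2=b_1+b_2$ (both sums defined), there are $d_1,d_2,d_3,d_4\in E$ with $d_1+d_2=a_1$, $d_3+d_4=a_2$, $d_1+d_3=b_1$, $d_2+d_4=b_2$. A measure on $E$ is a map $m:E\to[0,\infty)$ with $m(a+b)=m(a)+m(b)$ whenever $a+b$ is defined; a state is a measure with $s(1)=1$. $m_1\le^+m_2$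 means $m_1(a)\le m_2(a)$ for all $a\in E$. $\mathcal J(E)$ denotes the set of differences of two measures on $E$; ordered by $\le^+$ it is, when $E$ has (RDP), a Dedekind complete Abelian $\ell$-group, and $m_2\wedge t$ is the infimum in it. For measures $m_1,m_2$, $m_1\ll_\epsilon m_2$ means: for every $\epsilon>0$ there is $\delta>0$ such that $m_2(a)<\delta$ implies $m_1(a)<\epsilon$ for all $a\in E$. Convex combination means $\lambda_1,\lambda_2\ge0$, $\lambda_1+\lambda_2=1$. Uniqueness of the convex combination means: the coefficients $\lambda_i$ are uniquely determined, and $s_i$ is uniquely determined whenever $\lambda_i>0$; a term with coefficient $0$ may be omitted (relevant when no state of the required kind exists). *)

(* Defs.v *)
From mathcomp Require Import all_boot all_order all_algebra.
From mathcomp Require Import reals.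

Set Implicit Arguments.
Unset Strict Implicit.
Unset Printing Implicit Defensive.

Import Order.TTheory GRing.Theory Num.Theory.
Local Open Scope ring_scope.

(* The partial operation is option-valued: [padd a b = Some c] means that
   [a + b] is defined and equal to [c].  [peaA] is thus an equality of partial
   values: one side is defined iff the other one is, and then they agree. *)
Record pseudoEffectAlgebra := PseudoEffectAlgebra {
  pea_sort :> Type;
  padd : pea_sort -> pea_sort -> option pea_sort;
  pzero : pea_sort;
  pone : pea_sort;
  peaA : forall a b c,
    obind (fun ab => padd ab c) (padd a b) =
    obind (fun bc => padd a bc) (padd b c);
  pea_compl : forall a,
    (exists! d, padd a d = Some pone) /\ (exists! e, padd e a = Some pone);
  pea_conj : forall a b c, padd a b = Some c ->
    exists d e, padd d a = Some c /\ padd b e = Some c;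
  pea_unit : forall a, padd pone a <> None \/ padd a pone <> None -> a = pzero
}.

Arguments pone {p}.
Arguments pzero {p}.

Definition RDP (E : pseudoEffectAlgebra) : Prop :=
  forall a1 a2 b1 b2 c : E, padd a1 a2 = Some c -> padd b1 b2 = Some c ->
  exists d1 d2 d3 d4 : E,
    [/\ padd d1 d2 = Some a1, padd d3 d4 = Some a2,
        padd d1 d3 = Some b1 & padd d2 d4 = Some b2].

Section Measures.
Variables (R : realType) (E : pseudoEffectAlgebra).
Implicit Types m t s f g h : E -> R.

Definition is_measure m : Prop :=
  (forall a, 0 <= m a) /\
  (forall a b c, padd a b = Some c -> m c = m a + m b).

Definition is_state s : Prop := is_measure s /\ s pone = 1.

Definition le_plus f g : Prop := forall a, f a <= g a.

Definition in_J f : Prop :=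
  exists m1 m2, [/\ is_measure m1, is_measure m2 & forall a, f a = m1 a - m2 a].

(* Not the pointwise minimum, which need not be additive: the infimum is taken
   among the differences of two measures. *)
Definition is_meet_J f g h : Prop :=
  [/\ in_J h, le_plus h f, le_plus h g &
      forall k, in_J k -> le_plus k f -> le_plus k g -> le_plus k h].

Definition ac_eps m1 m2 : Prop :=
  forall e : R, 0 < e ->
  exists2 d : R, 0 < d & forall a, m2 a < d -> m1 a < e.

Definition lebesgue_dec t m m1 m2 : Prop :=
  [/\ is_measure m1, is_measure m2, (forall a, m a = m1 a + m2 a),
      ac_eps m1 t &
      forall m', is_measure m' -> ac_eps m' t -> le_plus m' m2 ->
        forall a, m' a = 0].

(* A term with coefficient 0 may be omitted: [s1] (resp. [s2]) is constrained
   only when [l1] (resp. [l2]) is positive.  States of the required kind need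
   not exist: for [t = 0], no state is absolutely continuous w.r.t. [t]. *)
Definition lebesgue_convex_dec t s (l1 l2 : R) s1 s2 : Prop :=
  [/\ [/\ 0 <= l1, 0 <= l2 & l1 + l2 = 1],
      (forall a, s a = l1 * s1 a + l2 * s2 a),
      (0 < l1 -> is_state s1 /\ ac_eps s1 t) &
      (0 < l2 -> is_state s2 /\
         forall s' (al : R), is_state s' -> ac_eps s' t -> 0 <= al ->
           le_plus (fun a => al * s' a) s2 -> al = 0)].

End Measures.

(* Main.v *)
Require Import Defs.
From mathcomp Require Import all_boot all_order all_algebra.
From mathcomp Require Import boolp classical_sets reals.
From mathcomp Require Import lra.

Set Implicit Arguments.
Unset Strict Implicit.
Unset Printing Implicit Defensive.

Import Order.TTheory GRing.Theory Num.Theory.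
Local Open Scope ring_scope.

(** The absolutely continuous part [m1] is the supremum of all measures below
    [m] that are absolutely continuous with respect to [t].  By (RDP) two
    measures have a join that is again a measure and is dominated by their sum,
    so this family is upward directed and its pointwise supremum is additive.
    A measure [m'] of the family with [m' 1] close to [m1 1] is uniformly close
    to [m1], because the measure [m1 - m'] attains its maximum at [1]; hence
    [m1] is itself absolutely continuous.  A measure below [m - m1] that is
    absolutely continuous can be added to [m1], so it vanishes; applied to the
    positive part of an element of J(E) below both [m - m1] and [t], this gives
    the meet.  The statement on states follows by normalisation. *)

(** * Arithmetic of the partial addition *)

Lemma paddA_right (E : pseudoEffectAlgebra) (a b c ab s : E) :
  padd a b = Some ab -> padd ab c = Some s ->
  exists2 bc, padd b c = Some bc & padd a bc = Some s.
Proof.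
move=> hab hs; have := peaA a b c; rewrite hab /= hs.
by case: (padd b c) => [bc|] //= h; exists bc.
Qed.

Lemma paddA_left (E : pseudoEffectAlgebra) (a b c bc s : E) :
  padd b c = Some bc -> padd a bc = Some s ->
  exists2 ab, padd a b = Some ab & padd ab c = Some s.
Proof.
move=> hbc hs; have := peaA a b c; rewrite hbc /= hs.
by case: (padd a b) => [ab|] //= h; exists ab.
Qed.

(** First [1 + 0 = 1], since the complement of [1] is [0]. If [e + a = 1], reassociating
    [(e + a) + 0] makes both [a] and [a + 0] right complements of [e], so they coincide. *)
Lemma padd0 (E : pseudoEffectAlgebra) (a : E) : padd a pzero = Some a.
Proof.
have one0 : padd (pone : E) pzero = Some pone.
  have [[d [hd _]] _] := pea_compl (pone : E).
  by rewrite -{1}(@pea_unit E d) //; left; rewrite hd.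
have [_ [e [he _]]] := pea_compl a.
have [x hx ex] := paddA_right he one0.
have [[d [_ uniq_d]] _] := pea_compl e.
by rewrite hx -(uniq_d _ he) -(uniq_d _ ex).
Qed.

(* Conjugation lets [a2] and [b1] swap places at the cost of replacing [b1] by
   some [d] on which every measure takes the same value. *)
Lemma padd_interchange (E : pseudoEffectAlgebra) (a b c a1 a2 b1 b2 : E) :
  padd a b = Some c -> padd a1 a2 = Some a -> padd b1 b2 = Some b ->
  exists z d u v, [/\ padd a2 b1 = Some z, padd d a2 = Some z,
    padd a1 d = Some u, padd a2 b2 = Some v & padd u v = Some c].
Proof.
move=> hc ha hb.
have [y hy a1y] := paddA_right ha hc.
have [z hz zb2] := paddA_left hb hy.
have [d [_ [hd _]]] := pea_conj hz.
have [v hv dv] := paddA_right hd zb2.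
have [u hu uv] := paddA_left dv a1y.
by exists z, d, u, v.
Qed.

(** * Measures and absolute continuity *)

Section MeasureTheory.
Variables (R : realType) (E : pseudoEffectAlgebra).
Implicit Types (m n p t s : E -> R) (a b c : E).

Lemma measure_pzero m : is_measure m -> m pzero = 0.
Proof. by case=> _ mD; have := mD _ _ _ (padd0 pzero); lra. Qed.

Lemma measure_le_pone m a : is_measure m -> m a <= m pone.
Proof.
case=> m0 mD; have [[d [hd _]] _] := pea_compl a.
by rewrite (mD _ _ _ hd) lerDl.
Qed.

Lemma measure_eq0 m a : is_measure m -> m pone = 0 -> m a = 0.
Proof.
by move=> hm m1; have := measure_le_pone a hm; have := hm.1 a; rewrite m1; lra.
Qed.

Lemma is_measure0 : is_measure (fun _ : E => 0 : R).
Proof. by split=> // *; rewrite addr0. Qed.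

Lemma is_measureD m n :
  is_measure m -> is_measure n -> is_measure (fun a => m a + n a).
Proof.
move=> [m0 mD] [n0 nD]; split=> [a|a b c h]; first exact: addr_ge0.
by rewrite (mD _ _ _ h) (nD _ _ _ h) addrACA.
Qed.

Lemma is_measureB m n : is_measure m -> is_measure n -> le_plus n m ->
  is_measure (fun a => m a - n a).
Proof.
move=> [m0 mD] [n0 nD] nm; split=> [a|a b c h]; first by rewrite subr_ge0.
by rewrite (mD _ _ _ h) (nD _ _ _ h); lra.
Qed.

Lemma is_measureZ m (k : R) : 0 <= k -> is_measure m ->
  is_measure (fun a => k * m a).
Proof.
move=> k0 [m0 mD]; split=> [a|a b c h]; first exact: mulr_ge0.
by rewrite (mD _ _ _ h) mulrDr.
Qed.

Lemma is_state_normalize m : is_measure m -> 0 < m pone ->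
  is_state (fun a => m a / m pone).
Proof.
move=> hm m1; split; last by rewrite divff ?gt_eqF.
under [X in is_measure X]funext do rewrite mulrC.
by apply: is_measureZ => //; rewrite invr_ge0 ltW.
Qed.

Lemma ac_eps_le m n t : le_plus m n -> ac_eps n t -> ac_eps m t.
Proof.
move=> mn nt e e0; have [d d0 h] := nt e e0.
by exists d => // a /h; apply: le_lt_trans.
Qed.

Lemma ac_epsxx t : ac_eps t t.
Proof. by move=> e e0; exists e. Qed.

Lemma ac_eps0 t : ac_eps (fun _ => 0) t.
Proof. by move=> e e0; exists 1. Qed.

Lemma ac_epsD m n t : ac_eps m t -> ac_eps n t ->
  ac_eps (fun a => m a + n a) t.
Proof.
move=> mt nt e e0; have e20 : 0 < e / 2 by lra.
have [d d0 hm] := mt _ e20; have [d' d'0 hn] := nt _ e20.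
exists (Num.min d d'); first by rewrite lt_min d0.
by move=> a; rewrite lt_min => /andP[/hm ? /hn ?]; lra.
Qed.

Lemma ac_epsZ m t (k : R) : 0 <= k -> ac_eps m t -> ac_eps (fun a => k * m a) t.
Proof.
rewrite le_eqVlt => /predU1P[<- _|k0 mt e e0].
  by under [X in ac_eps X]funext do rewrite mul0r; exact: ac_eps0.
have [|d d0 h] := mt (e / k); first by rewrite divr_gt0.
by exists d => // a /h; rewrite ltr_pdivlMr // mulrC.
Qed.

(** * Joins of measures *)

(** Riesz-Kantorovich formula, with ordered decompositions since [+] need not commute. *)
Definition measure_join m n a : R :=
  sup [set x | exists b c, padd b c = Some a /\ x = m b + n c]%classic.

Section Join.
Variables (m n : E -> R).
Hypotheses (hm : is_measure m) (hn : is_measure n).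

Lemma measure_join_ub a b c : padd b c = Some a ->
  m b + n c <= measure_join m n a.
Proof.
move=> h; apply: ub_le_sup; last by exists b, c.
exists (m pone + n pone) => _ [b' [c' [_ ->]]].
by rewrite lerD ?measure_le_pone.
Qed.

Lemma measure_join_le a (x : R) :
  (forall b c, padd b c = Some a -> m b + n c <= x) -> measure_join m n a <= x.
Proof.
move=> h; apply: ge_sup; first by exists (m a + n pzero), a, pzero; rewrite padd0.
by move=> _ [b [c [/h bc ->]]].
Qed.

Lemma le_measure_joinl : le_plus m (measure_join m n).
Proof.
by move=> a; have := measure_join_ub (padd0 a); rewrite measure_pzero // addr0.
Qed.

Lemma le_measure_joinr : le_plus n (measure_join m n).
Proof.
(* Conjugating [a + 0 = a] gives [d + a = a]; then [0 <= m d] suffices. *)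
move=> a; have [d [_ [/measure_join_ub h _]]] := pea_conj (padd0 a).
by apply: le_trans h; rewrite lerDr hm.1.
Qed.

Lemma measure_join_lub p : is_measure p -> le_plus m p -> le_plus n p ->
  le_plus (measure_join m n) p.
Proof.
move=> [_ pD] mp np a; apply: measure_join_le => b c /pD ->.
exact: lerD.
Qed.

Lemma is_measure_join : RDP E -> is_measure (measure_join m n).
Proof.
move=> rdp; split=> [a|a b c hc].
  exact: le_trans (hm.1 a) (le_measure_joinl a).
apply/eqP; rewrite eq_le; apply/andP; split.
  apply: measure_join_le => c1 c2 hc12.
  (* A common refinement splits [c1 + c2] into decompositions [d1 + d2] of [a] and [d3 + d4] of
     [b]. *)
  have [d1 [d2 [d3 [d4 [h1 h2 h3 h4]]]]] := rdp _ _ _ _ _ hc hc12.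
  rewrite (hm.2 _ _ _ h3) (hn.2 _ _ _ h4) addrACA.
  by rewrite lerD ?measure_join_ub.
rewrite -lerBrDr; apply: measure_join_le => a1 a2 ha.
rewrite lerBrDr addrC -lerBrDr; apply: measure_join_le => b1 b2 hb.
(* Conversely, decompositions of [a] and [b] merge into [u + v = c], with [m d = m b1] because
   [d + a2 = a2 + b1]. *)
have [z [d [u [v [hz hd hu hv huv]]]]] := padd_interchange hc ha hb.
have := measure_join_ub huv; rewrite (hm.2 _ _ _ hu) (hn.2 _ _ _ hv).
have := hm.2 _ _ _ hz; rewrite (hm.2 _ _ _ hd); lra.
Qed.

End Join.

(** * The Lebesgue decomposition and its uniqueness *)

Definition ac_part t m a : R :=
  sup [set x | exists n, [/\ is_measure n, ac_eps n t, le_plus n m & x = n a]]%classic.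

Section LebesgueDecomposition.
Variables (t m : E -> R).
Hypotheses (rdp : RDP E) (hm : is_measure m).

Lemma le_ac_part n : is_measure n -> ac_eps n t -> le_plus n m ->
  le_plus n (ac_part t m).
Proof.
move=> hn nt nm a; apply: ub_le_sup; last by exists n.
by exists (m a) => _ [p [_ _ pm ->]].
Qed.

Lemma ac_part_le a (x : R) :
  (forall n, is_measure n -> ac_eps n t -> le_plus n m -> n a <= x) ->
  ac_part t m a <= x.
Proof.
move=> h; apply: ge_sup; last by move=> _ [n [hn nt nm ->]]; exact: h.
(* The zero measure shows that the set under the supremum is nonempty. *)
exists 0, (fun=> 0); split=> //; first exact: is_measure0.
  exact: ac_eps0.
exact: hm.1.
Qed.

Lemma ac_part_le_self : le_plus (ac_part t m) m.
Proof. by move=> a; apply: ac_part_le => n _ _; apply. Qed.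

Lemma is_measure_ac_part : is_measure (ac_part t m).
Proof.
have ge0 a : 0 <= ac_part t m a.
  by apply: (le_ac_part is_measure0 (@ac_eps0 t)); exact: hm.1.
split=> // a b c hc; apply/eqP; rewrite eq_le; apply/andP; split.
  apply: ac_part_le => n hn nt nm; rewrite (hn.2 _ _ _ hc).
  by rewrite lerD // le_ac_part.
rewrite -lerBrDr; apply: ac_part_le => n hn nt nm.
rewrite lerBrDr addrC -lerBrDr; apply: ac_part_le => p hp pt pm.
(* Two competitors [n] at [a] and [p] at [b] are replaced by the single competitor
   [measure_join n p], which is additive at [c]. *)
rewrite lerBrDr; have hj := is_measure_join hn hp rdp.
have jm := measure_join_lub hm nm pm.
have jt : ac_eps (measure_join n p) t.
  apply: ac_eps_le (ac_epsD nt pt); apply: measure_join_lub.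
  - exact: is_measureD.
  - by move=> x; rewrite lerDl hp.1.
  - by move=> x; rewrite lerDr hn.1.
apply: le_trans (le_ac_part hj jt jm c); rewrite (hj.2 _ _ _ hc) addrC.
by rewrite lerD ?le_measure_joinl ?le_measure_joinr.
Qed.

Lemma ac_eps_ac_part : ac_eps (ac_part t m) t.
Proof.
move=> e e0; have e20 : 0 < e / 2 by lra.
have [n [hn nt nm hlt]] : exists n, [/\ is_measure n, ac_eps n t, le_plus n m &
    ac_part t m pone - e / 2 < n pone].
  apply: contrapT => hne; have : ac_part t m pone <= ac_part t m pone - e / 2.
    apply: ac_part_le => n hn nt nm; rewrite leNgt; apply/negP => hlt.
    by apply: hne; exists n.
  lra.
have [d d0 hd] := nt _ e20; exists d => // a /hd.
have hB := is_measureB is_measure_ac_part hn (le_ac_part hn nt nm).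
have := measure_le_pone a hB; lra.
Qed.

Lemma lebesgue_dec_ac_part :
  lebesgue_dec t m (ac_part t m) (fun a => m a - ac_part t m a).
Proof.
have hp := is_measure_ac_part.
split=> //.
- exact: is_measureB hm hp ac_part_le_self.
- by move=> a; rewrite addrC subrK.
- exact: ac_eps_ac_part.
move=> n hn nt nle a; apply/eqP; rewrite eq_le hn.1 andbT.
have : ac_part t m a + n a <= ac_part t m a.
  apply: (le_ac_part (is_measureD hp hn)) => [|x].
    exact: ac_epsD ac_eps_ac_part nt.
  by have := nle x; lra.
lra.
Qed.

(** Since [n1] competes in the supremum, [ac_part t m - n1] is a measure. It is absolutely
    continuous and lies below [m - n1 = n2], so the maximality condition on [n2] makes it vanish. *)
Lemma lebesgue_dec_uniq n1 n2 : lebesgue_dec t m n1 n2 ->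
  n1 = ac_part t m /\ n2 = (fun a => m a - ac_part t m a).
Proof.
move=> [hn1 hn2 mE n1t n2max].
have n1m : le_plus n1 m by move=> a; rewrite mE lerDl hn2.1.
have n1le := le_ac_part hn1 n1t n1m.
have n1E : n1 = ac_part t m.
  apply/funext => a; have := n2max _ (is_measureB is_measure_ac_part hn1 n1le).
  move=> /(_ _ _ a) /= h; apply/esym/eqP; rewrite -subr_eq0; apply/eqP/h.
    by apply: ac_eps_le ac_eps_ac_part => x; rewrite gerBl hn1.1.
  by move=> x; have := ac_part_le_self x; rewrite mE; lra.
by split=> //; apply/funext => a; rewrite mE -n1E; lra.
Qed.

End LebesgueDecomposition.

(** * The meet in J(E) *)

Lemma lebesgue_dec_meet t m m1 m2 : RDP E -> is_measure t ->
  lebesgue_dec t m m1 m2 -> is_meet_J m2 t (fun=> 0).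
Proof.
move=> rdp ht [_ hm2 _ _ m2max]; split.
- exists (fun=> 0), (fun=> 0); split; [exact: is_measure0..|].
  by move=> a; rewrite subr0.
- exact: hm2.1.
- exact: ht.1.
move=> k [p [q [hp hq kE]]] km2 kt a.
have hj := is_measure_join hp hq rdp.
(* The join of [p] and [q] minus [q] is the positive part of [k = p - q]. Any measure [n] above [k]
   dominates it, because [n + q] is above both [p] and [q]. *)
have hw := is_measureB hj hq (le_measure_joinr hp hq).
have w_le n : is_measure n -> le_plus k n ->
    le_plus (fun x => measure_join p q x - q x) n.
  move=> hn kn x; rewrite lerBlDr.
  apply: (measure_join_lub (is_measureD hn hq)) => y.
    by have := kn y; rewrite kE; lra.
  by rewrite lerDr hn.1.
have := m2max _ hw (ac_eps_le (w_le _ ht kt) (@ac_epsxx t)) (w_le _ hm2 km2) a.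
by have := le_measure_joinl hp hq a; rewrite kE; lra.
Qed.

(** * States and convex combinations *)

(* With [m pone = 0] the quotient [m a / m pone] is the junk value [0], which is
   also the value of [m a]. *)
Lemma measure_normalizeE m a : is_measure m -> m pone * (m a / m pone) = m a.
Proof.
move=> hm; have [m1|m1] := eqVneq (m pone) 0; last by rewrite mulrC divfK.
by rewrite m1 mul0r measure_eq0.
Qed.

Lemma lebesgue_dec_convex t s m1 m2 : is_state s -> lebesgue_dec t s m1 m2 ->
  lebesgue_convex_dec t s (m1 pone) (m2 pone)
    (fun a => m1 a / m1 pone) (fun a => m2 a / m2 pone).
Proof.
move=> [_ s1] [hm1 hm2 sE m1t m2max]; split.
- by split; rewrite -?sE ?s1 ?hm1.1 ?hm2.1.
- by move=> a; rewrite !measure_normalizeE.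
- move=> l1; split; first exact: is_state_normalize.
  under [X in ac_eps X]funext do rewrite mulrC.
  by apply: ac_epsZ => //; rewrite invr_ge0 ltW.
move=> l2; split; first exact: is_state_normalize.
move=> s' al [hs' s'1] s't al0 le_s2.
(* Rescaling by [m2 pone] turns [al * s'] below the normalised state into a measure below [m2],
   which must vanish at [1]. *)
have k0 : 0 <= m2 pone * al by rewrite mulr_ge0 // ltW.
have := m2max _ (is_measureZ k0 hs') (ac_epsZ k0 s't) _ pone.
rewrite s'1 mulr1 => h; have /eqP : m2 pone * al = 0.
  apply: h => a; rewrite -(measure_normalizeE a hm2) -mulrA.
  by rewrite ler_pM2l //; exact: le_s2.
by rewrite mulf_eq0 gt_eqF //= => /eqP.
Qed.

(** This reduces uniqueness of the convex combination to [lebesgue_dec_uniq]. When a coefficient is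
    [0] its function is arbitrary, but the product is the zero measure. *)
Lemma convex_lebesgue_dec t s (k1 k2 : R) r1 r2 :
  lebesgue_convex_dec t s k1 k2 r1 r2 ->
  lebesgue_dec t s (fun a => k1 * r1 a) (fun a => k2 * r2 a).
Proof.
have measure_scale (k : R) (r : E -> R) : 0 <= k -> (0 < k -> is_measure r) ->
    is_measure (fun a => k * r a).
  rewrite le_eqVlt => /predU1P[<- _|k0 /(_ k0)]; last exact: is_measureZ (ltW k0).
  by under [X in is_measure X]funext do rewrite mul0r; exact: is_measure0.
move=> [[k10 k20 k12] sE h1 h2]; split=> //.
- by apply: measure_scale => // /h1[[]].
- by apply: measure_scale => // /h2[[]].
- move: k10; rewrite le_eqVlt => /predU1P[<-|k1_gt0].
    by under [X in ac_eps X]funext do rewrite mul0r; exact: ac_eps0.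
  by apply: ac_epsZ (ltW k1_gt0) (h1 k1_gt0).2.
move=> n hn nt nle a; apply: measure_eq0 => //.
move: k20; rewrite le_eqVlt => /predU1P[k2E|k2_gt0].
  by apply: le_anti; rewrite hn.1 andbT (le_trans (nle _)) // -k2E mul0r.
have [//|n1] := eqVneq (n pone) 0.
have n1_gt0 : 0 < n pone by rewrite lt0r n1 hn.1.
have [_ r2max] := h2 k2_gt0.
(* If [n] were nonzero, its normalisation scaled by [n pone / k2] would be [n / k2], which is below
   [r2]. *)
have : n pone / k2 = 0.
  apply: (r2max (fun x => n x / n pone)).
  - exact: is_state_normalize.
  - under [X in ac_eps X]funext do rewrite mulrC.
    by apply: ac_epsZ => //; rewrite invr_ge0 ltW.
  - by rewrite divr_ge0 ?hn.1 ?ltW.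
  move=> x; rewrite mulrAC measure_normalizeE //.
  by rewrite ler_pdivrMr // mulrC; exact: nle.
by move/eqP; rewrite mulf_eq0 invr_eq0 (gt_eqF k2_gt0) orbF => /eqP.
Qed.

Lemma scaled_state_uniq m r (k : R) : 0 <= k -> (0 < k -> is_state r) ->
  (fun a => k * r a) = m ->
  k = m pone /\ (0 < m pone -> r = (fun a => m a / m pone)).
Proof.
move=> k0 hr <-; move: k0; rewrite le_eqVlt => /predU1P[<-|k0].
  by rewrite mul0r ltxx.
(* Evaluating at [1] recovers the coefficient, as a state has value [1] there. *)
have [_ r1] := hr k0; rewrite r1 mulr1; split=> // _.
by apply/funext => a; rewrite mulrC mulKf ?gt_eqF.
Qed.

End MeasureTheory.

Theorem theorem4p8 (R : realType) (E : pseudoEffectAlgebra) (hE : RDP E)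
    (t : E -> R) (ht : is_measure t) :
  (forall m : E -> R, is_measure m ->
     exists m1 m2 : E -> R,
       [/\ lebesgue_dec t m m1 m2,
           (forall n1 n2 : E -> R, lebesgue_dec t m n1 n2 ->
              n1 = m1 /\ n2 = m2) &
           is_meet_J m2 t (fun _ => 0)]) /\
  (forall s : E -> R, is_state s ->
     exists (l1 l2 : R) (s1 s2 : E -> R),
       lebesgue_convex_dec t s l1 l2 s1 s2 /\
       (forall (k1 k2 : R) (r1 r2 : E -> R),
          lebesgue_convex_dec t s k1 k2 r1 r2 ->
          [/\ k1 = l1, k2 = l2, (0 < l1 -> r1 = s1) & (0 < l2 -> r2 = s2)])).
Proof.
split=> [m hm|s hs].
  have hdec := lebesgue_dec_ac_part t hE hm.
  exists (ac_part t m), (fun a => m a - ac_part t m a); split=> //.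
    exact: lebesgue_dec_uniq.
  exact: lebesgue_dec_meet hdec.
have hdec := lebesgue_dec_ac_part t hE hs.1.
set m1 := ac_part t s in hdec; set m2 := (fun a => _) in hdec.
exists (m1 pone), (m2 pone), (fun a => m1 a / m1 pone), (fun a => m2 a / m2 pone).
split; first exact: lebesgue_dec_convex.
move=> k1 k2 r1 r2 hk.
have [m1E m2E] := lebesgue_dec_uniq hE hs.1 (convex_lebesgue_dec hk).
have [[k10 k20 _] _ h1 h2] := hk.
have [k1E r1E] := scaled_state_uniq k10 (fun h => (h1 h).1) m1E.
have [k2E r2E] := scaled_state_uniq k20 (fun h => (h2 h).1) m2E.
by split.
Qed.
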